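(* Let $(X,d)$ be a Hadamard space or, more generally, a convex metric space. Let $A \subset X$ be a nonempty finite set. Then for every exponent $p \ge 1$, the set of $p$-means of $A$ coincides with the set of $A$-minimal points. (In particular the set of medians, i.e. $1$-means, the set of barycenters, i.e. $2$-means, and the set of $p$-means for every $p\ge 1$ all coincide, and $\mathrm{mean}(A) = \mathrm{minimal}(A)$.)
   Context: A metric space $(X,d)$ is convex (in Takahashi's sense) if for all $u,v \in X$ and $\lambda \in [0,1]$ there exists $x \in X$ with $d(a,x) \le \lambda d(a,u) + (1-\lambda) d(a,v)$ for all $a \in X$. A Hadamard space is a complete CAT(0) geodesic space. For a nonempty finite $A \subset X$, let $\Delta^A = \{ w \in \mathbb{R}^A : w_a \ge 0 \ \forall a\in A,\ \sum_{a \in A} w_a = 1\}$. For $p \ge 1$, a point $\bar x \in X$ is a $p$-mean of $A$ if there exists $w \in \Delta^A$ such that $\bar x$ minimizes $x \mapsto \sum_{a \in A} w_a d(a,x)^p$ over $X$. A $1$-mean is called a median, a $2$-mean a barycenter; $\mathrm{mean}(A)$ is the set of barycenters. A point $\bar x$ is $A$-minimal if no $x \in X$ satisfies $d(a,x) < d(a,\bar x)$ for all $a \in A$; $\mathrm{minimal}(A)$ is the set of $A$-minimal points. *)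

(* Defs.v *)
From HB Require Import structures.
From mathcomp Require Import all_boot all_order all_algebra finmap.
From mathcomp Require Import all_classical all_reals all_analysis.

Set Implicit Arguments.
Unset Strict Implicit.
Unset Printing Implicit Defensive.

Import Order.TTheory GRing.Theory Num.Theory.

Local Open Scope classical_set_scope.
Local Open Scope ring_scope.

Section metric_spaces.
Context {R : realType}.

(* Convexity in the sense of Takahashi. *)
Definition convex_metric_space (X : metricType R) : Prop :=
  forall (u v : X) (l : R), 0 <= l <= 1 ->
    exists x : X, forall a : X,
      mdist a x <= l * mdist a u + (1 - l) * mdist a v.

Definition complete_metric_space (X : metricType R) : Prop :=
  forall u : nat -> X, cauchy (u @ \oo) -> exists l : X, u @ \oo --> l.

(* Geodesics are parametrized proportionally to arc length on [0, 1];
   the values of c outside [0, 1] are irrelevant. *)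
Definition geodesic (X : metricType R) (x y : X) (c : R -> X) : Prop :=
  [/\ c 0 = x, c 1 = y &
      forall s t : R, 0 <= s <= 1 -> 0 <= t <= 1 ->
        mdist (c s) (c t) = `|s - t| * mdist x y].

Definition geodesic_space (X : metricType R) : Prop :=
  forall x y : X, exists c : R -> X, geodesic x y c.

(* The Euclidean plane is 'rV[R]_2 with this distance; the library norm on
   matrices is the sup norm. *)
Definition edist (x y : 'rV[R]_2) : R :=
  Num.sqrt (\sum_(i < 2) (x 0 i - y 0 i) ^+ 2).

(* Vertices are indexed cyclically: in 'I_3, i + 1 is computed modulo 3, and
   c i is the side from v i to v (i + 1). *)
Definition geodesic_triangle (X : metricType R) (v : 'I_3 -> X)
    (c : 'I_3 -> R -> X) : Prop :=
  forall i : 'I_3, geodesic (v i) (v (i + 1)) (c i).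

Definition comparison_triangle (X : metricType R) (v : 'I_3 -> X)
    (w : 'I_3 -> 'rV[R]_2) : Prop :=
  forall i j : 'I_3, edist (w i) (w j) = mdist (v i) (v j).

(* The comparison point of c i s, for s in [0, 1]. *)
Definition comparison_point (w : 'I_3 -> 'rV[R]_2) (i : 'I_3) (s : R) :
    'rV[R]_2 :=
  (1 - s) *: w i + s *: w (i + 1).

Definition cat0 (X : metricType R) : Prop :=
  forall (v : 'I_3 -> X) (c : 'I_3 -> R -> X) (w : 'I_3 -> 'rV[R]_2),
    geodesic_triangle v c -> comparison_triangle v w ->
    forall (i j : 'I_3) (s t : R), 0 <= s <= 1 -> 0 <= t <= 1 ->
      mdist (c i s) (c j t) <=
      edist (comparison_point w i s) (comparison_point w j t).

Definition hadamard_space (X : metricType R) : Prop :=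
  [/\ complete_metric_space X, geodesic_space X & cat0 X].

Section finite_subset.
Context {X : metricType R}.
Implicit Types (A : {fset X}) (p : R).

Definition simplex A : set {ffun A -> R} :=
  [set w | (forall a : A, 0 <= w a) /\ \sum_(a : A) w a = 1].

Definition p_means p A : set X :=
  [set xbar | exists2 w : {ffun A -> R}, simplex w &
     forall x : X, \sum_(a : A) w a * mdist (val a) xbar `^ p <=
                   \sum_(a : A) w a * mdist (val a) x `^ p].

Definition medians A : set X := p_means 1 A.

(* 2-means are also called barycenters. *)
Definition mean A : set X := p_means 2 A.

Definition minimal A : set X :=
  [set xbar | ~ exists x : X,
     forall a : X, a \in A -> mdist a x < mdist a xbar].

End finite_subset.
End metric_spaces.

(* Main.v *)
(* A p-mean is minimal because a point strictly closer to every a in A would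
   strictly decrease every term of positive weight.  Conversely, if xbar is
   minimal, the functions f_a x = d(a, x)^p - d(a, xbar)^p are never negative
   simultaneously, and convexity of X and of t^p make them jointly
   "convexlike": for all u, v, l some x satisfies
   f_a x <= l f_a u + (1 - l) f_a v for all a.  The Fan-Glicksberg-Hoffman
   alternative then yields weights with sum_a w_a f_a >= 0.  It follows by
   induction from the case of two functions: the weights for f_2, ..., f_n are
   obtained on the convexlike subset where f_1 < 0.  A Hadamard space is convex
   by comparison with a planar triangle: for the point x dividing [u, v],
   Stewart's theorem in the plane and |d(a, u) - d(a, v)| <= d(u, v) give
   d(a, x) <= l d(a, u) + (1 - l) d(a, v). *)

Require Import Defs.
From HB Require Import structures.
From mathcomp Require Import all_boot all_order all_algebra finmap.
From mathcomp Require Import all_classical all_reals all_analysis.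
From mathcomp Require Import ring lra.

Set Implicit Arguments.
Unset Strict Implicit.
Unset Printing Implicit Defensive.

Import Order.TTheory GRing.Theory Num.Theory.

Local Open Scope classical_set_scope.
Local Open Scope ring_scope.

(** * Alternatives for convexlike functions *)

(** Points with [h] negative bound an admissible [l] from below, points with [g] negative from
    above. The inequality [cross] puts each lower bound below each upper one, so the supremum of the
    lower bounds is admissible. *)
Lemma alternative_pair (R : realType) (X : Type) (D : set X) (g h : X -> R) :
  (forall u v (l : R), D u -> D v -> 0 <= l <= 1 -> exists x, [/\ D x,
     g x <= l * g u + (1 - l) * g v & h x <= l * h u + (1 - l) * h v]) ->
  ~ (exists2 x, D x & g x < 0 /\ h x < 0) ->
  exists2 l, 0 <= l <= 1 & forall x, D x -> 0 <= l * g x + (1 - l) * h x.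
Proof.
move=> conv_gh no_neg.
have h_ge0 x : D x -> g x < 0 -> 0 <= h x.
  by move=> Dx gx; rewrite leNgt; apply/negP => hx; apply: no_neg; exists x.
have g_ge0 x : D x -> h x < 0 -> 0 <= g x.
  by move=> Dx hx; rewrite leNgt; apply/negP => gx; apply: no_neg; exists x.
have [[v0 Dv0 hv0]|h_nonneg] := pselect (exists2 v, D v & h v < 0); last first.
  exists 0 => [|x Dx]; first by rewrite lexx ler01.
  rewrite mul0r add0r subr0 mul1r leNgt; apply/negP => hx.
  by apply: h_nonneg; exists x.
have cross u v : D u -> D v -> g u < 0 -> h v < 0 -> h v * g u <= h u * g v.
  move=> Du Dv gu hv; rewrite leNgt; apply/negP => lt_uv.
  have hu := h_ge0 _ Du gu; have gv := g_ge0 _ Dv hv.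
  (* l equalizes the two convex combinations; their common value has the sign
     of h u * g v - h v * g u. *)
  pose d := (g v - h v) + (h u - g u).
  have d_gt0 : 0 < d by rewrite /d; lra.
  pose l := (g v - h v) / d.
  have l01 : 0 <= l <= 1.
    by rewrite /l divr_ge0 ?ler_pdivrMr ?mul1r ?/d //=; lra.
  have [x [Dx gx hx]] := conv_gh u v l Du Dv l01.
  have eq_val k1 k2 : l * k1 + (1 - l) * k2 =
      ((g v - h v) * k1 + (h u - g u) * k2) / d.
    by rewrite /l /d; field; rewrite -/d gt_eqF.
  apply: no_neg; exists x => //; rewrite !eq_val in gx hx.
  by split; [apply: le_lt_trans gx _ | apply: le_lt_trans hx _];
    rewrite pmulr_llt0 ?invr_gt0 //; lra.
(* When h v < 0 <= g v, the condition l * g v + (1 - l) * h v >= 0 reads l >= - h v / (g v - h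
   v). *)
pose S := [set s | exists2 v, D v /\ h v < 0 & s = - h v / (g v - h v)].
have S_v v : D v -> h v < 0 -> S (- h v / (g v - h v)).
  by move=> Dv hv; exists v.
have S_le1 : ubound S 1.
  move=> _ [v [Dv hv] ->]; have gv := g_ge0 _ Dv hv.
  by rewrite ler_pdivrMr; lra.
have S_n0 : S !=set0 by exists (- h v0 / (g v0 - h v0)); exact: S_v.
have supS_le1 : sup S <= 1 by exact: ge_sup.
have le_supS v : D v -> h v < 0 -> - h v / (g v - h v) <= sup S.
  by move=> Dv hv; apply: ub_le_sup; [exists 1 | exact: S_v].
have supS_ge0 : 0 <= sup S.
  apply: le_trans (le_supS _ Dv0 hv0).
  by have := g_ge0 _ Dv0 hv0 => gv0; apply: divr_ge0; lra.
exists (sup S) => [|x Dx]; first by rewrite supS_ge0.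
have [hx|hx] := ltP (h x) 0.
  have gx := g_ge0 _ Dx hx; have := le_supS _ Dx hx.
  by rewrite ler_pdivrMr; lra.
have [gx|gx] := ltP (g x) 0; last by rewrite addr_ge0 ?mulr_ge0 ?subr_ge0.
have : sup S <= h x / (h x - g x).
  apply: ge_sup => // _ [v [Dv hv] ->]; have gv := g_ge0 _ Dv hv.
  rewrite ler_pdivrMr; last lra.
  rewrite mulrAC ler_pdivlMr; last lra.
  by have := cross _ _ Dx Dv gx hv; lra.
by rewrite ler_pdivlMr; lra.
Qed.

(** The domain [D] is arbitrary so that the induction can restrict it to [D']. *)
Lemma convexlike_alternative (R : realType) (X : Type) (I : eqType)
    (f : I -> X -> R) (s : seq I) (D : set X) :
  uniq s -> s != [::] ->
  (forall u v (l : R), D u -> D v -> 0 <= l <= 1 -> exists2 x, D x &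
     {in s, forall i, f i x <= l * f i u + (1 - l) * f i v}) ->
  ~ (exists2 x, D x & {in s, forall i, f i x < 0}) ->
  exists w : I -> R, [/\ forall i, 0 <= w i, \sum_(i <- s) w i = 1 &
    forall x, D x -> 0 <= \sum_(i <- s) w i * f i x].
Proof.
elim: s D => // i s IHs D /= /andP[i_s uniq_s] _ conv_f no_neg.
have [s0|s_n0] := eqVneq s [::].
  exists (fun=> 1); rewrite s0 !big_seq1; split=> // x Dx.
  rewrite big_seq1 mul1r leNgt; apply/negP => fx; apply: no_neg.
  by exists x => // j; rewrite s0 inE => /eqP ->.
pose D' := [set x | D x /\ f i x < 0].
have [||w [w_ge0 sum_w w_f]] := IHs D' uniq_s s_n0.
- move=> u v l [Du fu] [Dv fv] l01.
  have [x Dx fx] := conv_f u v l Du Dv l01.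
  exists x => [|j js]; last by apply: fx; rewrite inE js orbT.
  split=> //; apply: le_lt_trans (fx i (mem_head _ _)) _.
  have /andP[l0 l1] := l01.
  have [->|l_n0] := eqVneq l 0; first by rewrite mul0r add0r subr0 mul1r.
  have l_gt0 : 0 < l by rewrite lt_def l_n0 l0.
  by nra.
- case=> x [Dx fi_x] fx; apply: no_neg; exists x => // j.
  by rewrite inE => /predU1P[->//|/fx].
(* A common negative point of [f i] and the weighted sum would lie in [D'], where that sum is
   nonnegative. *)
have [||l l01 l_f] := @alternative_pair R X D
    (fun x => \sum_(j <- s) w j * f j x) (f i).
- move=> u v l Du Dv l01; have [x Dx fx] := conv_f u v l Du Dv l01.
  exists x; split=> //; last exact: fx (mem_head _ _).
  rewrite !mulr_sumr -big_split /= big_seq [leRHS]big_seq.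
  apply: ler_sum => j js.
  have jis : j \in i :: s by rewrite inE js orbT.
  by have := ler_wpM2l (w_ge0 j) (fx j jis); lra.
- by case=> x Dx [lt0 fx]; have := w_f x (conj Dx fx); rewrite leNgt lt0.
have /andP[l0 l1] := l01.
exists (fun j => if j == i then 1 - l else l * w j).
have eq_sum (k : I -> R) :
    \sum_(j <- s) (if j == i then 1 - l else l * w j) * k j =
    l * \sum_(j <- s) w j * k j.
  rewrite mulr_sumr big_seq [RHS]big_seq; apply: eq_bigr => j js.
  by rewrite (negPf (memPn i_s j js)) mulrA.
split=> [j||x Dx].
- by case: ifP => _; rewrite ?subr_ge0 // mulr_ge0.
- have /= := eq_sum (fun=> 1).
  under eq_bigr do rewrite mulr1; under [in RHS]eq_bigr do rewrite mulr1.
  by rewrite big_cons eqxx => ->; rewrite sum_w mulr1 subrK.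
- by rewrite big_cons eqxx eq_sum addrC l_f.
Qed.

(** * Hadamard spaces are convex *)

Section hadamard.
Context {R : realType}.

Definition plane_point (x y : R) : 'rV[R]_2 :=
  \row_(k < 2) if k == 0 then x else y.

Lemma edist_plane_point (x y x' y' : R) :
  Defs.edist (plane_point x y) (plane_point x' y') =
  Num.sqrt ((x - x') ^+ 2 + (y - y') ^+ 2).
Proof. by rewrite /Defs.edist big_ord_recl big_ord1 !mxE. Qed.

Lemma sqrtr_eq (x y : R) : 0 <= y -> x = y ^+ 2 -> Num.sqrt x = y.
Proof. by move=> y0 ->; rewrite sqrtr_sqr ger0_norm. Qed.

(** Supplies the comparison triangle that [cat0] takes as given. Subtracting the two circle
    equations determines [x] when D > 0; the triangle inequalities give |x| <= b, so [y] is real. *)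
Lemma triangle_apex (D b c : R) : 0 <= D -> 0 <= b -> 0 <= c ->
  c <= D + b -> b <= D + c -> D <= b + c ->
  exists x y : R, x ^+ 2 + y ^+ 2 = b ^+ 2 /\ (x - D) ^+ 2 + y ^+ 2 = c ^+ 2.
Proof.
move=> D0 b0 c0 cDb bDc Dbc.
have [DE|D_n0] := eqVneq D 0.
  have bc : b = c by lra.
  by exists 0, b; rewrite DE bc; split; ring.
have D_gt0 : 0 < D by rewrite lt_def D_n0.
pose x := (D ^+ 2 + b ^+ 2 - c ^+ 2) / (2 * D).
have xE : 2 * D * x = D ^+ 2 + b ^+ 2 - c ^+ 2 by rewrite /x; field.
have x_le : `|x| <= b.
  rewrite ler_norml; have D2 : 0 < 2 * D by lra.
  have c_le : 0 <= (D + b - c) * (D + b + c) by rewrite mulr_ge0 //; lra.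
  have c_ge : 0 <= (c - D + b) * (c + D - b) by rewrite mulr_ge0 //; lra.
  by apply/andP; split; rewrite -(ler_pM2l D2) xE; lra.
have y_ge0 : 0 <= b ^+ 2 - x ^+ 2.
  by rewrite subr_ge0 -(real_normK (num_real x)) lerXn2r ?nnegrE.
exists x, (Num.sqrt (b ^+ 2 - x ^+ 2)); rewrite !sqr_sqrtr //.
split; lra.
Qed.

Definition vertices3 (T : Type) (a b c : T) (i : 'I_3) : T :=
  nth a [:: a; b; c] i.

Lemma hadamard_convex (X : metricType R) :
  hadamard_space X -> convex_metric_space X.
Proof.
move=> [_ geo cat] u v l /andP[l0 l1].
(* As [l] is the weight of [u], the point lies at distance (1 - l) * d(u, v) from [u]. *)
have [c cP] := geo u v; exists (c (1 - l)) => a.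
have [c1 c1P] := geo v a; have [c2 c2P] := geo a u.
have [||||||x [y [xb xc]]] := @triangle_apex
    (mdist u v) (mdist a u) (mdist a v); rewrite ?mdist_ge0 //.
- by rewrite addrC metric_triangle.
- by rewrite addrC (metric_sym u v) metric_triangle.
- by rewrite (metric_sym a u) metric_triangle.
pose w := vertices3 (plane_point 0 0) (plane_point (mdist u v) 0)
  (plane_point x y).
have tri : geodesic_triangle (vertices3 u v a) (vertices3 c c1 c2).
  by case=> [[|[|[|//]]] ?].
have comp : comparison_triangle (vertices3 u v a) w.
  case=> [[|[|[|//]]] ?]; case=> [[|[|[|//]]] ?];
    rewrite /w /vertices3 /= edist_plane_point; apply: sqrtr_eq;
    rewrite ?mdist_ge0 // ?mdistxx ?(metric_sym u a) ?(metric_sym v a)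
      ?(metric_sym v u); lra.
have t01 : 0 <= 1 - l <= 1 by lra.
have z01 : 0 <= (0 : R) <= 1 by lra.
(* Side 2 runs from [a] to [u], so its parameter 0 gives the vertex [a], compared here with a point
   of side 0. *)
have := cat _ _ _ tri comp (inord 2) 0 0 (1 - l) z01 t01.
have i2 : (inord 2 : 'I_3) = Ordinal (isT : 2 < 3)%N.
  by apply: val_inj; rewrite /= inordK.
rewrite i2 {1 2}/vertices3 /=; have [-> _ _] := c2P.
move=> /le_trans; apply.
have -> : comparison_point w (Ordinal (isT : 2 < 3)%N) 0 = plane_point x y.
  by rewrite /comparison_point subr0 scale1r scale0r addr0.
have -> : comparison_point w 0 (1 - l) = plane_point ((1 - l) * mdist u v) 0.
  rewrite /comparison_point /w /vertices3 /=; apply/rowP => k.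
  by rewrite !mxE; case: ifP => _; ring.
rewrite edist_plane_point.
have uv : mdist a u <= mdist a v + mdist u v.
  by rewrite (metric_sym u v) metric_triangle.
have vu : mdist a v <= mdist a u + mdist u v by rewrite metric_triangle.
have r0 : 0 <= l * mdist a u + (1 - l) * mdist a v.
  by rewrite addr_ge0 // mulr_ge0 ?mdist_ge0 //; lra.
(* With b = d(a, u) and c = d(a, v), the square of l b + (1 - l) c is l b^2 + (1 - l) c^2 - l (1 -
   l) (b - c)^2; Stewart's formula has d(u, v)^2 in place of (b - c)^2. *)
rewrite -(ger0_norm r0) -sqrtr_sqr; apply: ler_wsqrtr.
have diff : (mdist a u - mdist a v) ^+ 2 <= mdist u v ^+ 2.
  by rewrite -real_normK ?num_real // lerXn2r ?nnegrE ?mdist_ge0 //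
    ler_norml; lra.
have l1l : 0 <= l * (1 - l) by rewrite mulr_ge0 //; lra.
have := ler_wpM2l l1l diff.
(* Stewart's theorem for the cevian from the apex. *)
have -> : (x - (1 - l) * mdist u v) ^+ 2 + (y - 0) ^+ 2 =
    l * (x ^+ 2 + y ^+ 2) + (1 - l) * ((x - mdist u v) ^+ 2 + y ^+ 2)
    - l * (1 - l) * mdist u v ^+ 2 by ring.
by rewrite xb xc; lra.
Qed.

End hadamard.

(** * Means and minimal points *)

Section p_means.
Context {R : realType} {X : metricType R}.
Implicit Types (A : {fset X}) (p : R).

Lemma p_means_minimal A p : 1 <= p -> p_means p A `<=` minimal A.
Proof.
move=> p1 xbar [w [w_ge0 sum_w] w_min] [x x_lt].
have p_gt0 : 0 < p by lra.
have := w_min x; rewrite leNgt => /negP; apply.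
have lt_pow (a : A) : mdist (val a) x `^ p < mdist (val a) xbar `^ p.
  by apply: gt0_ltr_powR; rewrite ?nnegrE ?mdist_ge0 //; exact/x_lt/valP.
(* Weights may vanish, so strictness must come from one positive weight. *)
have [a w_gt0] : exists a : A, 0 < w a.
  apply: contrapT => w_le0.
  have : \sum_(a : A) w a <= 0.
    by apply: sumr_le0 => a _; rewrite leNgt; apply/negP => w_gt0; apply: w_le0; exists a.
  by rewrite sum_w ler10.
rewrite (bigD1 a) //= [ltRHS](bigD1 a) //=; apply: ltr_leD.
  by rewrite ltr_pM2l // lt_pow.
by apply: ler_sum => b _; apply: ler_wpM2l => //; exact/ltW/lt_pow.
Qed.

(** The point from Takahashi convexity serves every [p]: raise its bound to the power [p], then use
    convexity of t^p. *)
Lemma convex_dist_powR p (X_conv : convex_metric_space X) (u v : X) (l : R) :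
  1 <= p -> 0 <= l <= 1 -> exists x : X, forall a : X,
    mdist a x `^ p <= l * mdist a u `^ p + (1 - l) * mdist a v `^ p.
Proof.
move=> p1 l01; have [x xP] := X_conv u v l l01; exists x => a.
have /andP[l0 l1] := l01.
have := @convex_powR R p p1 (Itv01 l0 l1) (mdist a u) (mdist a v).
rewrite !inE /= !in_itv /= !mdist_ge0 => /(_ isT isT).
apply: le_trans; apply: ge0_ler_powR; rewrite ?nnegrE ?mdist_ge0 //.
- by lra.
- by rewrite addr_ge0 // mulr_ge0 ?mdist_ge0 ?subr_ge0.
Qed.

Lemma minimal_p_means A p : convex_metric_space X -> A != fset0 -> 1 <= p ->
  minimal A `<=` p_means p A.
Proof.
move=> X_conv A_n0 p1 xbar xbar_min.
have p_gt0 : 0 < p by lra.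
(* Subtracting constants keeps the functions convexlike, since l + (1 - l) = 1. *)
have [||||w [w_ge0 sum_w w_f]] := @convexlike_alternative R X A
  (fun a x => mdist (val a) x `^ p - mdist (val a) xbar `^ p)
  (index_enum A) setT.
- exact: index_enum_uniq.
- have [a aA] := fset0Pn _ A_n0; apply/eqP => A0.
  by have := mem_index_enum [` aA]%fset; rewrite A0.
- move=> u v l _ _ l01.
  have [x xP] := convex_dist_powR X_conv u v p1 l01.
  by exists x => // a _; have := xP (val a); lra.
- case=> x _ x_neg; apply: xbar_min; exists x => a aA.
  have := x_neg [` aA]%fset (mem_index_enum _); rewrite subr_lt0 /=.
  apply: contraTT; rewrite -!leNgt => le_ax.
  by apply: ge0_ler_powR; rewrite ?nnegrE ?mdist_ge0 // ltW.
exists [ffun a => w a].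
  by split=> [a|]; [rewrite ffunE | under eq_bigr do rewrite ffunE].
move=> x; rewrite -subr_ge0 -sumrB.
by under eq_bigr do rewrite ffunE -mulrBr; exact: w_f.
Qed.

End p_means.

Theorem theorem6p1 (R : realType) (X : metricType R)
    (hX : hadamard_space X \/ convex_metric_space X)
    (A : {fset X}) (hA : A != fset0) :
  [/\ forall p : R, 1 <= p -> p_means p A = minimal A,
      medians A = mean A,
      forall p : R, 1 <= p -> p_means p A = mean A
    & mean A = minimal A].
Proof.
have X_conv : convex_metric_space X by case: hX => // /hadamard_convex.
have pE p : 1 <= p -> p_means p A = minimal A.
  move=> p1; apply/seteqP; split; first exact: p_means_minimal.
  exact: minimal_p_means.
have meanE : mean A = minimal A by apply: pE; rewrite ler1n.
by split=> // [|p p1]; rewrite meanE; apply: pE.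
Qed.
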